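(* In Blizzard, played on a finite graph $G=(V,E)$ with a set $X$ of exits and a starting vertex $s$, the trapper has a winning strategy if and only if $s$ is adjacent to a vertex of $W$, where $W$ is defined as follows: $W_0=X$, and for $k\ge 1$, $W_k$ is the set of vertices having at least two neighbors in $\bigcup_{i<k}W_i$; the construction is continued until it adds no new vertices, and $W=\bigcup_{k}W_k$.
   Context: Blizzard is a two-player game. An instance consists of a finite graph $G=(V,E)$, a set $X\subseteq V$ of vertices called exits, and a starting vertex $s$ for the first player, the trapper. In each round the trapper first moves from his current vertex to an adjacent vertex along an edge still present; then the second player, the Storm, permanently deletes one edge incident with the trapper's current vertex. The trapper wins if he reaches an exit; the Storm wins if the trapper ends up in a connected component of the current graph containing no exit. *)

(* Defs.v *)
From mathcomp Require Import all_boot.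

Set Implicit Arguments.
Unset Strict Implicit.
Unset Printing Implicit Defensive.

Section Graph.
Variable V : finType.
Implicit Types (E : {set {set V}}) (u v : V).

(* A graph on the vertex set V is given by its edge set; edges are unordered
   pairs of distinct vertices. *)
Definition simple_graph E : Prop := forall f : {set V}, f \in E -> #|f| = 2.

Definition adj E : rel V := fun u v => [set u; v] \in E.

End Graph.

Section Game.
Variables (V : finType) (E : {set {set V}}) (X : {set V}) (s : V).

(* The completed rounds in chronological order; a round (v, f) consists of the
   vertex v the trapper moved to and the edge f the Storm then deleted. *)
Definition history : Type := seq (V * {set V}).

Definition cur_edges (h : history) : {set {set V}} :=
  E :\: [set f in unzip2 h].

Definition cur_vertex (h : history) : V := last s (unzip1 h).

Definition legal_move (h : history) (v : V) : bool :=
  adj (cur_edges h) (cur_vertex h) v.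

Definition legal_deletion (h : history) (v : V) (f : {set V}) : bool :=
  (f \in cur_edges h) && (v \in f).

Definition storm_won (h : history) : bool :=
  ~~ [exists x in X, connect (adj (cur_edges h)) (cur_vertex h) x].

Definition trapper_strategy : Type := history -> V.

Definition storm_strategy : Type := history -> V -> {set V}.

(* After a legal move the edge just traversed can be deleted, so legal
   strategies of the Storm always exist. *)
Definition legal_storm (tau : storm_strategy) : Prop :=
  forall (h : history) (v : V),
    legal_move h v -> legal_deletion h v (tau h v).

Definition play (sigma : trapper_strategy) (tau : storm_strategy) (n : nat) :
  history := iter n (fun h => rcons h (sigma h, tau h (sigma h))) [::].

(* The trapper's move of round n (counted from 0) takes him to an exit, all his
   moves so far being legal and the Storm not having won before. An exit is
   reached by a move: starting on an exit is not by itself a win. *)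
Definition trapper_wins_play (sigma : trapper_strategy) (tau : storm_strategy) :
  Prop :=
  exists n : nat,
    (forall m : nat, m <= n ->
       ~~ storm_won (play sigma tau m) /\
       legal_move (play sigma tau m) (sigma (play sigma tau m))) /\
    sigma (play sigma tau n) \in X.

Definition trapper_has_winning_strategy : Prop :=
  exists sigma : trapper_strategy,
    forall tau : storm_strategy,
      legal_storm tau -> trapper_wins_play sigma tau.

End Game.

Section Layers.
Variables (V : finType) (E : {set {set V}}) (X : {set V}).

Definition next_layer (k : nat) (below : {set V}) : {set V} :=
  if k is 0 then X else [set v | 2 <= #|[set u in below | adj E v u]|].

Fixpoint layers_below (k : nat) : {set V} :=
  if k is k'.+1 then layers_below k' :|: next_layer k' (layers_below k')
  else set0.

Definition layer (k : nat) : {set V} := next_layer k (layers_below k).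

Lemma layers_belowE (k : nat) : layers_below k = \bigcup_(i < k) layer i.
Proof.
elim: k => [|k IH]; first by rewrite big_ord0.
by rewrite big_ord_recr /= -IH.
Qed.

Lemma layer0 : layer 0 = X.
Proof. by []. Qed.

Lemma layerE (k : nat) : 0 < k ->
  layer k = [set v | 2 <= #|[set u in \bigcup_(i < k) layer i | adj E v u]|].
Proof. by case: k => // k _; rewrite -layers_belowE. Qed.

(* Once a layer adds no new vertex none of the later ones does, so stopping the
   construction there gives the same set as the union over all k. *)
Definition in_W (v : V) : Prop := exists k : nat, v \in layer k.

End Layers.

(* Main.v *)
Require Import Defs.
From mathcomp Require Import all_boot.

(** Write [L k] for [layers_below k]. If [s] has a neighbor in [W], the trapper
    always moves into [L k] for the least possible [k]. The vertex [v] he reaches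
    is then outside [L k.-1], and no edge inside [L k] has been deleted so far;
    as [v] has two neighbors in [L k.-1] (or is an exit), one of them survives the
    Storm's next deletion, and that deletion touches [v], hence no edge inside
    [L k.-1]. So [k] decreases until an exit is reached.
    Otherwise the trapper always stands on a vertex with no present neighbor in
    [W]. He moves to some [v] outside [W], which has at most one neighbor in [W];
    the Storm deletes the corresponding edge and restores the invariant. *)

Set Implicit Arguments.
Unset Strict Implicit.
Unset Printing Implicit Defensive.

Section Positions.
Variables (V : finType) (E : {set {set V}}) (X : {set V}) (s : V).

Lemma cur_edges_rcons (h : history V) v f :
  cur_edges E (rcons h (v, f)) = cur_edges E h :\ f.
Proof.
apply/setP=> g; rewrite !inE /unzip2 map_rcons mem_rcons inE negb_or.
by rewrite andbA.
Qed.

Lemma cur_vertex_rcons (h : history V) v f :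
  cur_vertex s (rcons h (v, f)) = v.
Proof. by rewrite /cur_vertex /unzip1 map_rcons last_rcons. Qed.

Lemma cur_edges_subset (h : history V) : cur_edges E h \subset E.
Proof. exact: subsetDl. Qed.

Lemma adj_subset (F F' : {set {set V}}) u v :
  F \subset F' -> adj F u v -> adj F' u v.
Proof. by move/subsetP; apply. Qed.

Lemma set2_injr (u v w : V) : [set u; v] = [set u; w] -> v = w.
Proof.
move=> eq_uvw.
have: v \in [set u; w] by rewrite -eq_uvw set22.
have: w \in [set u; v] by rewrite eq_uvw set22.
by rewrite !inE => /orP[] /eqP-> // /orP[] /eqP->.
Qed.

Lemma move_to_exit_not_storm_won (h : history V) v :
  legal_move E s h v -> v \in X -> ~~ storm_won E X s h.
Proof.
move=> hv vX; rewrite negbK; apply/existsP; exists v.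
by rewrite vX connect1.
Qed.

(** Used contrapositively, to carry the absence of a Storm win back by one round: a path to an exit
    after the round uses only earlier edges, and the traversed edge links the old vertex to it. *)
Lemma storm_won_rcons (h : history V) v f :
  legal_move E s h v -> storm_won E X s h ->
  storm_won E X s (rcons h (v, f)).
Proof.
move=> hv; apply: contra => /existsP[x /andP[xX vx]].
apply/existsP; exists x; rewrite xX.
apply: (connect_trans (connect1 hv)).
move: vx; rewrite cur_vertex_rcons; apply: connect_sub => y z yz.
by apply/connect1/(adj_subset _ yz); rewrite cur_edges_rcons subsetDl.
Qed.

End Positions.

Section LayerTheory.
Variables (V : finType) (E : {set {set V}}) (X : {set V}).
Local Notation L := (layers_below E X).

Lemma layers_below_mono i j : i <= j -> L i \subset L j.
Proof.
elim: j => [|j IHj]; first by rewrite leqn0 => /eqP->.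
rewrite leq_eqVlt ltnS => /predU1P[-> //|/IHj /subset_trans].
by apply; exact: subsetUl.
Qed.

Lemma in_WP v : in_W E X v <-> exists k, v \in L k.
Proof.
split=> [[k vk]|[k]]; first by exists k.+1; rewrite /= inE; apply/orP; right.
elim: k => [|k IHk]; rewrite /= inE // => /orP[/IHk //|]; by exists k.
Qed.

(** An increasing chain of subsets of [V] cannot grow forever. The indices are shifted because the
    step from [L 0] to [L 1] adds [X] and says nothing about the two-neighbor rule. *)
Lemma layers_below_stabilize : exists k, L k.+2 = L k.+1.
Proof.
have growth n : (exists k, L k.+2 = L k.+1) \/ n <= #|L n.+1|.
  elim: n => [|n [ex_k|leLn]]; [by right | by left |].
  have [eqL|neqL] := eqVneq (L n.+2) (L n.+1); [by left; exists n | right].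
  apply: leq_ltn_trans leLn _; apply: proper_card.
  by rewrite properEneq eq_sym neqL layers_below_mono.
by case: (growth #|V|.+1) => // /leq_trans /(_ (max_card _)); rewrite ltnn.
Qed.

(* The set [Z] is [W], obtained as a decidable set. *)
Lemma ex_closed_W : exists Z : {set V},
  [/\ X \subset Z,
      forall v, 1 < #|[set u in Z | adj E v u]| -> v \in Z
    & forall v, v \in Z -> in_W E X v].
Proof.
have [k stab] := layers_below_stabilize; exists (L k.+1); split=> [|v v2|v vL].
- by have := layers_below_mono (ltn0Sn k); rewrite {1}/layers_below set0U.
- by rewrite -stab inE; apply/orP; right; rewrite inE.
- by apply/in_WP; exists k.+1.
Qed.

End LayerTheory.

Section Trapper.
Variables (V : finType) (E : {set {set V}}) (X : {set V}) (s : V).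
Local Notation L := (layers_below E X).

Definition can_enter (A : {set V}) (h : history V) : bool :=
  [exists u in A, legal_move E s h u].

(** The recursion searches downward for the least index that can be entered. Both values [s] are
    dummies, never reached when [can_enter (L k) h] holds. *)
Fixpoint descend (k : nat) : trapper_strategy V := fun h =>
  if k is k'.+1 then
    if can_enter (L k') h then descend k' h
    else odflt s [pick u in L k'.+1 | legal_move E s h u]
  else s.

Lemma can_enterS (A B : {set V}) h :
  A \subset B -> can_enter A h -> can_enter B h.
Proof.
move/subsetP=> sAB /existsP[u /andP[/sAB uB hu]].
by apply/existsP; exists u; rewrite uB.
Qed.

Lemma descendP k h : can_enter (L k) h ->
  exists j, [/\ descend k h \in L j.+1, legal_move E s h (descend k h)
              & ~~ can_enter (L j) h].
Proof.
elim: k => [|k IHk] /=; first by case/existsP=> u; rewrite inE.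
case: ifP => [/IHk // | /negbT nk]; case: pickP => [u /andP[uL hu] _|none].
  by exists k.
by case/existsP=> u; rewrite none.
Qed.

Definition intact (A : {set V}) (h : history V) : Prop :=
  forall f : {set V}, f \in E -> f \subset A -> f \in cur_edges E h.

Lemma intact_descent j h v (f : {set V}) :
  intact (L j.+1) h -> v \in L j.+1 -> v \notin L j -> v \notin X -> v \in f ->
  intact (L j) (rcons h (v, f)) /\ can_enter (L j) (rcons h (v, f)).
Proof.
move=> ihj vj1 vj vX vf; split=> [g gE gL|].
  rewrite cur_edges_rcons in_setD1.
  have -> /= : g != f by apply: contraNneq vj => gf; apply: (subsetP gL); rewrite gf.
  by apply: ihj => //; apply: subset_trans gL (layers_below_mono _ _ (leqnSn j)).
move: (vj1); rewrite /= inE (negPf vj) /=.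
(* For [j = 0] the layer entered would be [X], which [v] avoids. *)
case: j {vj} ihj vj1 => [|j] ihj vj1; first by rewrite /= (negPf vX).
rewrite inE => /card_gt1P[u1 [u2 [u1P u2P neq_u]]].
(* Such an edge lies inside [L j.+2], so it was present before this deletion. *)
have keep u : u \in [set u in L j.+1 | adj E v u] -> [set v; u] != f ->
    can_enter (L j.+1) (rcons h (v, f)).
  rewrite inE => /andP[uL vu] neq_f; apply/existsP; exists u; rewrite uL /=.
  rewrite /legal_move cur_vertex_rcons cur_edges_rcons /adj in_setD1 neq_f.
  apply: ihj => //; apply/subsetP=> x /set2P[] -> //.
  exact: (subsetP (layers_below_mono E X (leqnSn j.+1))).
have [vu1|] := eqVneq [set v; u1] f; last exact: keep.
apply: (keep u2) => //; rewrite -vu1; apply: contraNneq neq_u => eq_v.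
by rewrite (set2_injr eq_v).
Qed.

(** The index [K] of the strategy stays fixed while [k] drops; the induction is strong because one
    move may skip several layers. *)
Lemma descend_wins_from K tau k m : legal_storm E s tau -> k <= K ->
  let h := play (descend K) tau in
  intact (L k) (h m) -> can_enter (L k) (h m) ->
  exists n, [/\ m <= n,
    forall i, m <= i <= n ->
      ~~ storm_won E X s (h i) /\ legal_move E s (h i) (descend K (h i))
    & descend K (h n) \in X].
Proof.
move=> legal_tau leKk h; elim/ltn_ind: k m leKk => k IHk m leKk ik ek.
have [j [vj1 hv nj]] := descendP (can_enterS (layers_below_mono E X leKk) ek).
have lt_jk : j < k.
  by rewrite ltnNge; apply: contraNN nj => /(layers_below_mono E X)/can_enterS->.
have vj : descend K (h m) \notin L j.
  by apply: contraNN nj => vj; apply/existsP; exists (descend K (h m)); rewrite vj.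
have [vX|vX] := boolP (descend K (h m) \in X).
  exists m; split=> // i; rewrite -eqn_leq => /eqP <-; split=> //.
  exact: move_to_exit_not_storm_won hv vX.
have ij : intact (L j.+1) (h m).
  by move=> f fE fL; apply: ik => //; apply: subset_trans fL (layers_below_mono _ _ lt_jk).
have /andP[_ vf] := legal_tau _ _ hv.
have [ij' ej'] := intact_descent ij vj1 vj vX vf.
have [n [lt_mn wins nX]] := IHk j lt_jk m.+1 (leq_trans (ltnW lt_jk) leKk) ij' ej'.
exists n; split=> // [|i /andP[]]; first exact: ltnW.
rewrite leq_eqVlt => /predU1P[<- _|lt_mi le_in]; last by apply: wins; rewrite lt_mi.
(* That the Storm has not won at round [m] is inherited from round [m.+1]. *)
split=> //; have [] := wins m.+1; first by rewrite leqnn.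
by move=> nwon _; apply: contraNN nwon; apply: storm_won_rcons.
Qed.

Lemma trapper_wins w :
  adj E s w -> in_W E X w -> trapper_has_winning_strategy E X s.
Proof.
move=> sw /in_WP[K wK]; exists (descend K) => tau legal_tau.
have [] := @descend_wins_from K tau K 0 legal_tau (leqnn K).
- by move=> f fE _; rewrite !inE.
- apply/existsP; exists w; rewrite wK /legal_move /adj !inE /=.
  exact: sw.
move=> n [_ wins nX]; exists n; split=> // m le_mn; exact: wins.
Qed.

End Trapper.

Section Storm.
Variables (V : finType) (E : {set {set V}}) (s : V) (Z : {set V}).
Hypothesis closedZ : forall v, 1 < #|[set u in Z | adj E v u]| -> v \in Z.

(** A deletion is compulsory; with no edge into [Z] to cut, the edge just traversed serves. *)
Definition block : storm_strategy V := fun h v =>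
  if [pick u in Z | adj (cur_edges E h) v u] is Some u then [set v; u]
  else [set v; cur_vertex s h].

Definition cut_off (h : history V) : Prop :=
  forall u, u \in Z -> ~~ legal_move E s h u.

Lemma block_legal : legal_storm E s block.
Proof.
move=> h v hv; rewrite /legal_deletion /block.
by case: pickP => [u /andP[_ vu]|_]; rewrite set21 andbT // setUC.
Qed.

Lemma cut_off_block h v :
  cut_off h -> legal_move E s h v -> cut_off (rcons h (v, block h v)).
Proof.
move=> cut hv u uZ; rewrite /legal_move cur_vertex_rcons cur_edges_rcons.
apply/negP; rewrite /adj in_setD1 /block => /andP[].
case: pickP => [w /andP[wZ vw]|none] neq_vw vu; last first.
  by have := none u; rewrite uZ /adj vu.
(* A neighbor [u] surviving besides the cut-off [w] would force [v] into [Z] by [closedZ]. *)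
have: v \notin Z by apply: contraL hv => /cut.
apply/negP; rewrite negbK; apply: closedZ; apply/card_gt1P; exists u, w; split.
- by rewrite inE uZ (adj_subset (cur_edges_subset E h)).
- by rewrite inE wZ (adj_subset (cur_edges_subset E h)).
- by apply: contraNneq neq_vw => ->.
Qed.

Lemma play_block_cut_off sigma n :
  let h := play sigma block in
  cut_off [::] -> (forall i, i < n -> legal_move E s (h i) (sigma (h i))) ->
  cut_off (h n).
Proof.
move=> h cut0; elim: n => // n IHn legal.
by apply: cut_off_block; [apply: IHn => i /ltnW/legal | apply: legal].
Qed.

Lemma storm_blocks (X : {set V}) : X \subset Z -> cut_off [::] ->
  ~ trapper_has_winning_strategy E X s.
Proof.
move=> sXZ cut0 [sigma /(_ _ block_legal) [n [legal nX]]].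
have [_ hn] := legal n (leqnn n).
have cutn : cut_off (play sigma block n).
  by apply: play_block_cut_off => // i /ltnW/legal[].
by have := cutn _ (subsetP sXZ _ nX); rewrite hn.
Qed.

End Storm.

Theorem theorem13 (V : finType) (E : {set {set V}}) (X : {set V}) (s : V)
    (hE : simple_graph E) :
  trapper_has_winning_strategy E X s <->
  exists w : V, adj E s w /\ in_W E X w.
Proof.
split=> [wins|[w [sw wW]]]; last exact: trapper_wins sw wW.
have [Z [sXZ closedZ ZW]] := ex_closed_W E X.
have [/existsP[w /andP[wZ sw]]|none] := boolP [exists w in Z, adj E s w].
  by exists w; split=> //; apply: ZW.
(* What remains is the invariant at the start, where no edge has been deleted. *)
case: (storm_blocks closedZ sXZ _ wins) => u uZ; apply: contraNN none => su.
apply/existsP; exists u; rewrite uZ.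
exact: adj_subset (cur_edges_subset E [::]) su.
Qed.
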